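(* Let $(S,\mathcal F,\mathcal L)$ be a $p$-local finite group. Then $(S,\mathcal F,\mathcal L)$ is nilpotent if and only if $S$ controls fusion of $\mathcal C_p$-subgroups in $\mathcal F$, i.e. for every $\mathcal C_p$-subgroup $P\le S$ and every $f\in\mathrm{Hom}_{\mathcal F}(P,S)$ there exists $s\in S$ with $f(x)=sxs^{-1}$ for all $x\in P$.
   Context: An element $x\in S$ is a $\mathcal C_p$-element if $x^p=1$ when $p$ is odd, or $x^4=1$ when $p=2$; a $\mathcal C_p$-subgroup is a subgroup generated by a single $\mathcal C_p$-element. Let $S$ be a finite $p$-group. For $P,Q\le S$, $\mathrm{Hom}_S(P,Q)$ is the set of maps $c_g\colon x\mapsto gxg^{-1}$ with $g\in S$, $gPg^{-1}\le Q$, and $\mathrm{Aut}_S(P)=\mathrm{Hom}_S(P,P)$. A fusion system $\mathcal F$ over $S$ is a category whose objects are the subgroups of $S$, with $\mathrm{Hom}_S(P,Q)\subseteq\mathrm{Hom}_{\mathcal F}(P,Q)\subseteq \mathrm{Inj}(P,Q)$, such that every morphism factors as an $\mathcal F$-isomorphism followed by an inclusion. Subgroups are $\mathcal F$-conjugate if they are isomorphic in $\mathcal F$. $P$ is fully centralized (resp. fully normalized) if $|C_S(P)|\ge |C_S(P')|$ (resp. $|N_S(P)|\ge|N_S(P')|$) for all $P'$ $\mathcal F$-conjugate to $P$. $\mathcal F$ is saturated if (I) every fully normalized $P$ is fully centralized and $\mathrm{Aut}_S(P)$ is a Sylow $p$-subgroup of $\mathrm{Aut}_{\mathcal F}(P)$,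 and (II) whenever $\phi\in\mathrm{Hom}_{\mathcal F}(P,S)$ with $\phi(P)$ fully centralized, $\phi$ extends to a morphism in $\mathcal F$ defined on $N_\phi=\{g\in N_S(P):\phi c_g\phi^{-1}\in \mathrm{Aut}_S(\phi(P))\}$. $P$ is $\mathcal F$-centric if $C_S(P')\le P'$ for all $P'$ $\mathcal F$-conjugate to $P$; $\mathcal F^c$ is the full subcategory on these. A centric linking system associated to $\mathcal F$ is a category $\mathcal L$ with objects the $\mathcal F$-centric subgroups, a functor $\pi\colon\mathcal L\to\mathcal F^c$ which is the identity on objects, and monomorphisms $\delta_P\colon P\to\mathrm{Aut}_{\mathcal L}(P)$, such that (A) $Z(P)$ (via $\delta_P$) acts freely on $\mathrm{Mor}_{\mathcal L}(P,Q)$ by composition and $\pi$ induces a bijection $\mathrm{Mor}_{\mathcal L}(P,Q)/Z(P)\to\mathrm{Hom}_{\mathcal F}(P,Q)$; (B) $\pi(\delta_P(g))=c_g$ for $g\in P$; (C) $f\circ\delta_P(g)=\delta_Q(\pi(f)(g))\circ f$ for $f\in\mathrm{Mor}_{\mathcal L}(P,Q)$, $g\in P$. A $p$-local finite group is a triple $(S,\mathcal F,\mathcal L)$ with $\mathcal F$ a saturated fusion system over $S$ and $\mathcal L$ an associated centric linking system. $(S,\mathcal F,\mathcal L)$ is called nilpotent if $\mathcal F=\mathcal F_S(S)$, the fusion system with $\mathrm{Hom}_{\mathcal F_S(S)}(P,Q)=\mathrm{Hom}_S(P,Q)$. *)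

(* Defs.v *)
From mathcomp Require Import all_boot all_fingroup pgroup center.

Set Implicit Arguments.
Unset Strict Implicit.
Unset Printing Implicit Defensive.

Local Open Scope group_scope.

Section FusionDefs.
Variable gT : finGroupType.

Definition conjm (g : gT) : gT -> gT := fun x => g * x * g^-1.

(* A morphism P -> Q is represented by a function gT -> gT, only its values on P matter. *)
Definition FusSys := {set gT} -> {set gT} -> (gT -> gT) -> Prop.

Definition HomS (S P Q : {set gT}) (f : gT -> gT) : Prop :=
  exists2 g, g \in S &
    [set g * x * g^-1 | x in P] \subset Q /\ {in P, f =1 conjm g}.

Definition injhom (P Q : {set gT}) (f : gT -> gT) : Prop :=
  [/\ {in P &, {morph f : x y / x * y}}, {in P &, injective f}
    & {in P, forall x, f x \in Q}].

Definition is_fusion_system (S : {group gT}) (F : FusSys) : Prop :=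
  [/\ (* Hom sets are sets of maps P -> Q: only values on P matter *)
      (forall (P Q : {group gT}) (f g : gT -> gT), P \subset S -> Q \subset S ->
          {in P, f =1 g} -> F P Q f -> F P Q g),
      (forall (P Q : {group gT}) f, P \subset S -> Q \subset S -> HomS S P Q f -> F P Q f),
      (forall (P Q : {group gT}) f, P \subset S -> Q \subset S -> F P Q f -> injhom P Q f),
      (forall (P Q R : {group gT}) f g, P \subset S -> Q \subset S -> R \subset S ->
          F P Q f -> F Q R g -> F P R (g \o f))
    &
      (forall (P Q : {group gT}) f, P \subset S -> Q \subset S -> F P Q f ->
          F P (f @: P) f /\
          exists g, [/\ F (f @: P) P g, {in P, g \o f =1 id} & {in f @: P, f \o g =1 id}])].

Definition Fiso (F : FusSys) (P P' : {set gT}) : Prop :=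
  exists f g, [/\ F P P' f, F P' P g, {in P, g \o f =1 id} & {in P', f \o g =1 id}].

Definition fully_centralized (S : {group gT}) (F : FusSys) (P : {set gT}) : Prop :=
  forall P' : {group gT}, P' \subset S -> Fiso F P P' -> #|'C_S(P')| <= #|'C_S(P)|.

Definition fully_normalized (S : {group gT}) (F : FusSys) (P : {set gT}) : Prop :=
  forall P' : {group gT}, P' \subset S -> Fiso F P P' -> #|'N_S(P')| <= #|'N_S(P)|.

Definition AutS_set (S : {group gT}) (P : {set gT}) : {set {perm gT}} :=
  [set a in Aut P | [exists g in S, ([set g * x * g^-1 | x in P] \subset P)
                                   && [forall x in P, a x == g * x * g^-1]]].

(* N_phi = {g in N_S(P) : phi c_g phi^-1 in Aut_S(phi(P))} *)
Definition Nphi (S : {group gT}) (P : {set gT}) (f : gT -> gT) : {set gT} :=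
  [set g in 'N_S(P) | [exists h in S,
      ([set h * y * h^-1 | y in f @: P] \subset f @: P)
      && [forall x in P, f (g * x * g^-1) == h * f x * h^-1]]].

Definition saturated (p : nat) (S : {group gT}) (F : FusSys) : Prop :=
  [/\ is_fusion_system S F,
      (forall P : {group gT}, P \subset S -> fully_normalized S F P ->
          fully_centralized S F P /\
          exists AutF : {set {perm gT}},
            (forall a : {perm gT}, a \in AutF <-> (a \in Aut P /\ F P P (fun x => a x)))
            /\ p.-Sylow(AutF) (AutS_set S P))
    &
      (forall (P : {group gT}) (f : gT -> gT), P \subset S -> F P S f ->
          fully_centralized S F (f @: P) ->
          exists psi, F (Nphi S P f) S psi /\ {in P, psi =1 f})].

Definition Fcentric (S : {group gT}) (F : FusSys) (P : {set gT}) : Prop :=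
  P \subset S /\
  forall P' : {group gT}, P' \subset S -> Fiso F P P' -> 'C_S(P') \subset P'.

(* Data of a category L (objects: subgroups, only the F-centric ones matter),
   with a functor pi to F and maps delta_P : P -> Aut_L(P). *)
Record linking_data := LinkingData {
  Mor : {set gT} -> {set gT} -> Type;
  comp : forall P Q R : {set gT}, Mor Q R -> Mor P Q -> Mor P R;
  idm : forall P : {set gT}, Mor P P;
  proj : forall P Q : {set gT}, Mor P Q -> gT -> gT;
  delta : forall P : {set gT}, gT -> Mor P P
}.

Definition is_linking_system (S : {group gT}) (F : FusSys) (L : linking_data) : Prop :=
  let cen := Fcentric S F in
  let M := Mor L in
  let cp := @comp L in
  let pr := @proj L in
     (forall (P Q R T : {group gT}), cen P -> cen Q -> cen R -> cen T ->
         forall (f : M P Q) (g : M Q R) (h : M R T),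
           cp _ _ _ h (cp _ _ _ g f) = cp _ _ _ (cp _ _ _ h g) f)
  /\ (forall (P Q : {group gT}), cen P -> cen Q -> forall f : M P Q,
           cp _ _ _ (idm L Q) f = f /\ cp _ _ _ f (idm L P) = f)
  /\ (forall (P Q R : {group gT}), cen P -> cen Q -> cen R ->
         forall (f : M P Q) (g : M Q R),
           F P Q (pr _ _ f) /\ {in P, pr _ _ (cp _ _ _ g f) =1 pr _ _ g \o pr _ _ f})
  /\ (forall P : {group gT}, cen P -> {in P, pr _ _ (idm L P) =1 id})
  /\ (forall P : {group gT}, cen P ->
         [/\ {in P &, forall g h, delta L P (g * h) = cp _ _ _ (delta L P g) (delta L P h)},
             delta L P 1 = idm L P
           & {in P &, injective (delta L P)}])
     (* (A): Z(P) acts freely, and pi induces a bijection Mor_L(P,Q)/Z(P) -> Hom_F(P,Q) *)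
  /\ (forall (P Q : {group gT}), cen P -> cen Q ->
         [/\ (forall (f : M P Q) z, z \in 'Z(P) -> cp _ _ _ f (delta L P z) = f -> z = 1),
             (forall phi, F P Q phi -> exists f : M P Q, {in P, pr _ _ f =1 phi})
           & (forall f g : M P Q, {in P, pr _ _ f =1 pr _ _ g} ->
                exists2 z, z \in 'Z(P) & g = cp _ _ _ f (delta L P z))])
  /\ (forall P : {group gT}, cen P -> forall g, g \in P ->
         {in P, pr _ _ (delta L P g) =1 conjm g})
  /\ (forall (P Q : {group gT}), cen P -> cen Q -> forall (f : M P Q) g, g \in P ->
         cp _ _ _ f (delta L P g) = cp _ _ _ (delta L Q (pr _ _ f g)) f).

Definition p_local_finite_group (p : nat) (S : {group gT}) (F : FusSys) (L : linking_data)
  : Prop :=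
  [/\ prime p, p.-group S, saturated p S F & is_linking_system S F L].

Definition nilpotent_fs (S : {group gT}) (F : FusSys) : Prop :=
  forall (P Q : {group gT}) (f : gT -> gT), P \subset S -> Q \subset S ->
    (F P Q f <-> HomS S P Q f).

Definition Cp_elt (p : nat) (x : gT) : bool :=
  if p == 2 then x ^+ 4 == 1 else x ^+ p == 1.

Definition Cp_subgroup (p : nat) (S : {group gT}) (P : {set gT}) : Prop :=
  exists2 x, x \in S & Cp_elt p x /\ P = <[x]>.

Definition controls_Cp_fusion (p : nat) (S : {group gT}) (F : FusSys) : Prop :=
  forall P : {group gT}, P \subset S -> Cp_subgroup p S P ->
    forall f : gT -> gT, F P S f ->
      exists2 s, s \in S & {in P, forall x, f x = s * x * s^-1}.

End FusionDefs.

(* Main.v *)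
(* Control of fusion of C_p-elements forces every p'-element of Aut_F(P) to be
   trivial: on a minimal invariant subgroup Q moved by it, x |-> x^p (x^4 if
   p = 2) is trivial, so Q consists of C_p-elements, which the automorphism
   moves only by S-conjugation, and coprimality along the lower central series
   of S gives a contradiction.  Hence Aut_F(R) = Aut_S(R) for R fully
   normalized, and, by downward induction on |P|, every isomorphism P -> R
   extends to N_S(P) and is therefore an S-conjugation. *)
Require Import Defs.
From mathcomp Require Import all_boot all_fingroup pgroup center.
From mathcomp Require Import cyclic commutator nilpotent maximal abelian sylow.
From Stdlib Require Import Classical.

Set Implicit Arguments.
Unset Strict Implicit.
Unset Printing Implicit Defensive.

Local Open Scope group_scope.

(** * Automorphisms of p'-order of a p-group, and the minimal invariant subgroups that they move *)

Section CoprimeAutomorphism.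

Variables (gT : finGroupType) (p : nat) (P : {group gT}) (a : {perm gT}).
Hypotheses (pP : p.-group P) (Aa : a \in Aut P) (p'a : p^'.-elt a).

Let aM : {in P &, {morph a : x y / x * y}}.
Proof. exact/morphicP/Aut_morphic. Qed.

Let aV : {in P, {morph a : x / x^-1}}.
Proof. by move=> x Px; have := morphV (autm Aa) Px; rewrite autmE. Qed.

Let aX n : {in P, {morph a : x / x ^+ n}}.
Proof. by move=> x Px; have := morphX (autm Aa) n Px; rewrite autmE. Qed.

(** If [a] fixes [c = x^-1 * a x], then [a ^+ n] sends [x] to [x * c ^+ n]. Taking [n = #[a]] shows
    that the order of [c], a power of p, divides the p'-number [#[a]], so [c = 1]. *)
Lemma coprime_aut_fixed x : x \in P -> a (x^-1 * a x) = x^-1 * a x -> a x = x.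
Proof.
move=> Px; set c := x^-1 * a x => ac.
have ax : a x = x * c by rewrite mulKVg.
have Pc : c \in P by rewrite groupM ?groupV ?Aut_closed.
have axn n : (a ^+ n) x = x * c ^+ n.
  elim: n => [|n IHn]; first by rewrite perm1 mulg1.
  by rewrite expgSr permM IHn aM ?groupX // aX // ac ax -mulgA -expgS.
have /eqP := axn #[a]; rewrite expg_order perm1 eq_sym -{2}[x]mulg1.
rewrite (inj_eq (mulgI x)) -order_dvdn => c_dv_a.
have /eqP : #[c] = 1%N.
  apply: (pnat_1 (mem_p_elt pP Pc)).
  exact: pnat_dvd c_dv_a p'a.
by rewrite order_eq1 ax => /eqP->; rewrite mulg1.
Qed.

Variable Q : {group gT}.
Hypotheses (sQP : Q \subset P) (aQ : {in Q, forall x, a x \in Q}).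

Hypothesis IHQ : forall N : {group gT}, N \proper Q ->
  {in N, forall x, a x \in N} -> {in N, a =1 id}.

Let PQ x : x \in Q -> x \in P. Proof. exact: (subsetP sQP). Qed.

(** The displacements [y^-1 * a y] are permuted by [a], so they generate an invariant subgroup. Were
    it proper, [IHQ] would make [a] fix all of them, and [coprime_aut_fixed] would give
    [a x = x]. *)
Lemma gen_displacement_eq (x : gT) :
  x \in Q -> a x != x -> <<[set x^-1 * a x | x in Q]>> = Q.
Proof.
move=> Qx; apply: contraNeq => neq.
set D := [set _ | _ in _] in neq.
have sDQ : D \subset Q.
  by apply/subsetP=> _ /imsetP[y Qy ->]; rewrite groupM ?groupV ?aQ.
have sgDQ : <<D>> \subset Q by rewrite gen_subG.
have aD : {in <<D>>, forall y, a y \in <<D>>}.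
  move=> y Dy; have := mem_morphim (autm Aa) (PQ (subsetP sgDQ _ Dy)) Dy.
  rewrite autmE morphim_gen ?(subset_trans sDQ) //.
  apply/subsetP/genS/subsetP=> _ /morphimP[z Pz /imsetP[t Qt ->] ->].
  rewrite /= autmE aM ?groupV ?PQ ?aQ // aV ?PQ //.
  by apply/imsetP; exists (a t); rewrite ?aQ.
apply/eqP/coprime_aut_fixed; first exact: PQ.
apply: (IHQ (N := <<D>>%G)) => //; first by rewrite properEneq neq.
by apply/mem_gen/imset_f.
Qed.

Hypothesis moved : exists2 x, x \in Q & a x != x.

(** By [IHQ], [a] fixes both [n] and [y * n * y^-1] for [n] in [N] and [y] in [Q]. Applying [a] to
    the latter shows that [y^-1 * a y] centralizes [n], and these displacements generate [Q]. *)
Lemma invariant_normal_central (N : {group gT}) :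
  N \proper Q -> N <| Q -> {in N, forall x, a x \in N} -> Q \subset 'C(N).
Proof.
move=> ltNQ nNQ aN; case: moved => x Qx /(gen_displacement_eq Qx) <-.
have aN1 := IHQ ltNQ aN; have sNQ := proper_sub ltNQ.
rewrite gen_subG; apply/subsetP=> _ /imsetP[y Qy ->].
apply/centP=> n Nn.
have Qn := subsetP sNQ _ Nn.
have Nny : y * n * y^-1 \in N.
  have := memJ_norm n (subsetP (normal_norm nNQ) _ (groupVr Qy)).
  by rewrite Nn conjgE invgK mulgA.
have := aN1 _ Nny.
rewrite !aM ?aV ?groupM ?groupV ?PQ // (aN1 _ Nn) => /= e.
apply: (mulgI y); apply: (mulIg (a y)^-1); rewrite /commute.
rewrite !mulgA mulgV mul1g e -!mulgA; congr (_ * (_ * _)).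
by rewrite mulgV mulg1.
Qed.

(* Every x ^ p lies in 'Phi(Q), which is central in Q and fixed by [a].  So
   x |-> x ^ e is an endomorphism of Q with [a]-fixed values; it kills every
   x^-1 * a x, and these generate Q. *)
Lemma minimal_moved_exponent : prime p ->
  {in Q, forall x, x ^+ (if p == 2 then 4 else p) = 1}.
Proof.
move=> p_pr; have pQ := pgroupS sQP pP.
case: moved => x0 Qx0 ax0; have genQ := gen_displacement_eq Qx0 ax0.
have ntQ : Q :!=: 1.
  apply: contraNneq ax0 => Q1; move: Qx0; rewrite Q1 => /set1P x01.
  by rewrite x01 -(autmE Aa) morph1.
have ltPhi := Phi_proper ntQ.
(* Invariance is an equality by counting, so [a] also preserves the characteristic subgroup
   ['Phi(Q)]. *)
have imQ : autm Aa @* Q = Q.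
  apply/eqP; rewrite eqEcard card_injm ?injm_autm // leqnn andbT.
  by apply/subsetP=> _ /morphimP[x _ Qx ->]; apply: aQ.
have aPhi : {in 'Phi(Q), forall x, a x \in 'Phi(Q)}.
  move=> x Phix; have Px := PQ (subsetP (Phi_sub Q) _ Phix).
  have := mem_morphim (autm Aa) Px Phix.
  by rewrite injm_Phi ?injm_autm // imQ autmE.
have aPhi1 := IHQ ltPhi aPhi.
have cPhi := invariant_normal_central ltPhi (Phi_normal Q) aPhi.
have Qc x y : x \in Q -> y \in 'Phi(Q) -> commute x y.
  by move=> Qx Phiy; apply: (centP (subsetP cPhi _ Qx)).
have PhiR x y : x \in Q -> y \in Q -> [~ x, y] \in 'Phi(Q).
  by move=> Qx Qy; rewrite (Phi_joing pQ) mem_gen // inE mem_commg.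
have PhiX x : x \in Q -> x ^+ p \in 'Phi(Q).
  move=> Qx; rewrite (Phi_joing pQ) mem_gen // inE orbC.
  by rewrite -[p in x ^+ p]expn1 (Mho_p_elt 1) ?(mem_p_elt pQ).
set e := if _ then _ else _.
have p_dv_e : p %| e by rewrite /e; case: eqP => // ->.
have PhiXe x : x \in Q -> x ^+ e \in 'Phi(Q).
  by move=> Qx; rewrite -(divnK p_dv_e) mulnC expgM groupX ?PhiX.
have eM x y : x \in Q -> y \in Q -> (x * y) ^+ e = x ^+ e * y ^+ e.
  move=> Qx Qy; rewrite expMg_Rmul; try by apply: Qc; rewrite ?PhiR.
  (* This power equals [[~ y ^+ p, x]], and [y ^+ p] is central in [Q]. *)
  have R1 : [~ y, x] ^+ p = 1.
    rewrite -commXg; last by apply: Qc; rewrite ?PhiR.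
    by apply/eqP/commgP/commute_sym/Qc; rewrite ?PhiX.
  (* The reason for the exponent 4 when p = 2: the binomial coefficient is 6 for 4, but 1 for 2. *)
  have /dvdnP[k ->] : p %| 'C(e, 2).
    rewrite /e; case: (altP (p =P 2)) => [-> //|p2].
    by rewrite prime_dvd_bin //= ltn_neqAle eq_sym p2 prime_gt1.
  by rewrite mulnC expgM R1 expg1n mulg1.
have gE : group_set [set x in Q | x ^+ e == 1].
  apply/group_setP; split=> [|x y]; first by rewrite inE group1 expg1n eqxx.
  rewrite !inE => /andP[Qx /eqP x1] /andP[Qy /eqP y1].
  by rewrite groupM // eM // x1 y1 mulg1 eqxx.
have sQE : <<[set x^-1 * a x | x in Q]>> \subset Group gE.
  rewrite gen_subG.
  apply/subsetP=> _ /imsetP[x Qx ->]; rewrite inE groupM ?groupV ?aQ //=.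
  by rewrite eM ?groupV ?aQ // -aX ?PQ // (aPhi1 _ (PhiXe _ Qx)) expgVn mulVg.
by move=> x; rewrite -{1}genQ => /(subsetP sQE); rewrite inE => /andP[_ /eqP].
Qed.

End CoprimeAutomorphism.

(* If x^-1 * a x = [x, s^-1] with s in S, then [a] moves elements one step down
   the lower central series of S; a minimal counterexample has only
   C_p-elements, so descending induction along that series applies. *)
Lemma coprime_aut_Cp_fusion_trivial (gT : finGroupType) (p : nat)
    (S P : {group gT}) (a : {perm gT}) :
  prime p -> p.-group S -> P \subset S -> a \in Aut P -> p^'.-elt a ->
  (forall x, x \in P -> Cp_elt p x ->
     exists2 s, s \in S & a x = s * x * s^-1) ->
  a = 1.
Proof.
move=> p_pr pS sPS Aa p'a fus; have pP := pgroupS sPS pS.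
suffices triv (Q : {group gT}) :
    Q \subset P -> {in Q, forall x, a x \in Q} -> {in Q, a =1 id}.
  apply/permP=> x; rewrite perm1; have [Px|] := boolP (x \in P).
    by apply: (triv P) => // y Py; rewrite Aut_closed.
  exact: out_Aut Aa.
have [n] := ubnP #|Q|; elim: n Q => // n IHn Q; rewrite ltnS => leQn sQP aQ.
have IHQ (N : {group gT}) : N \proper Q ->
    {in N, forall x, a x \in N} -> {in N, a =1 id}.
  move=> ltNQ; apply: IHn; first exact: leq_trans (proper_card ltNQ) leQn.
  exact: subset_trans (proper_sub ltNQ) sQP.
move=> x Qx; apply/eqP/negPn/negP=> ax.
have expQ := minimal_moved_exponent pP Aa p'a sQP aQ IHQ
  (ex_intro2 _ _ x Qx ax) p_pr.
have CpQ y : y \in Q -> Cp_elt p y.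
  by move=> Qy; move: (expQ y Qy); rewrite /Cp_elt; case: ifP => _ ->.
have nilS := pgroup_nil pS.
have LS1 : 'L_(nil_class S).+1(S) = 1 by apply/(lcn_nil_classP _ nilS).
(* Here [k] bounds the distance from the i.+1-st term to the trivial term of index
   [(nil_class S).+1]. Terms are numbered from 1, so [i = 0] is [S] itself. *)
have fixL k : forall i, nil_class S <= i + k ->
    {in Q, forall y, y \in 'L_i.+1(S) -> a y = y}.
  elim: k => [|k IHk] i lei y Qy Ly.
    have: y \in 'L_(nil_class S).+1(S).
      by apply: subsetP Ly; rewrite lcn_sub_leq // -(addn0 i).
    rewrite LS1 => /set1P->.
    by rewrite -(autmE Aa) morph1.
  have Py := subsetP sQP _ Qy.
  apply: (coprime_aut_fixed pP Aa p'a) => //.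
  apply: (IHk i.+1); first by rewrite addSnnS.
    by rewrite groupM ?groupV ?aQ.
  have [s Ss ->] := fus y Py (CpQ y Qy).
  have -> : y^-1 * (s * y * s^-1) = [~ y, s^-1].
    by rewrite commgEl conjgE invgK !mulgA.
  by rewrite lcnSn mem_commg ?groupV.
case/eqP: ax; apply: (fixL (nil_class S) 0%N) => //.
by rewrite lcn1 (subsetP sPS) ?(subsetP sQP).
Qed.

(** * Groups without nontrivial p'-elements, and the group Aut_S(P) *)

Lemma Sylow_eq_of_p'_trivial (gT : finGroupType) (p : nat) (G H : {group gT}) :
  p.-Sylow(G) H -> (forall x, x \in G -> p^'.-elt x -> x = 1) -> G :=: H.
Proof.
move=> sylH triv; have pG : p.-group G.
  (* An element of prime order other than p would be a nontrivial p'-element. *)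
  apply/pgroupP=> q q_pr /(Cauchy q_pr)[x Gx ox].
  apply/negPn/negP=> nqp; have x1 : x = 1.
    by apply: triv => //; rewrite /p_elt ox pnatE.
  by move: q_pr; rewrite -ox x1 order1.
apply/esym/eqP; rewrite eqEcard (pHall_sub sylH) (card_Hall sylH).
by rewrite (part_pnat_id pG) leqnn.
Qed.

Lemma AutS_set_group (gT : finGroupType) (S P : {group gT}) :
  group_set (AutS_set S P).
Proof.
apply/group_setP; split=> [|a b].
  rewrite inE group1; apply/existsP; exists 1; rewrite group1 /=.
  apply/andP; split.
    by apply/subsetP=> _ /imsetP[x Px ->]; rewrite mul1g invg1 mulg1.
  by apply/forall_inP=> x Px; rewrite perm1 mul1g invg1 mulg1.
case/setIdP=> Aa /existsP[g /andP[Sg /andP[_ /forall_inP ag]]].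
case/setIdP=> Ab /existsP[h /andP[Sh /andP[_ /forall_inP bh]]].
(* The product of permutations applies [a] first, whereas [g * x * g^-1] is a left action; hence the
   reversed order [h * g]. *)
have abE x : x \in P -> (a * b) x = (h * g) * x * (h * g)^-1.
  move=> Px; rewrite permM (eqP (bh _ (Aut_closed Aa Px))) (eqP (ag _ Px)).
  by rewrite invMg !mulgA.
apply/setIdP; split; first exact: groupM.
apply/existsP; exists (h * g); rewrite groupM //=.
apply/andP; split; last by apply/forall_inP=> x /abE->.
apply/subsetP=> _ /imsetP[x Px ->]; rewrite -abE //.
by rewrite Aut_closed // groupM.
Qed.

(** * Elementary properties of fusion systems and fully normalized conjugates *)

Section FusionSystem.

Variables (gT : finGroupType) (p : nat) (S : {group gT}) (F : FusSys gT).
Hypotheses (fusF : is_fusion_system S F).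
Implicit Types (P Q R : {group gT}).

Lemma fus_eq P Q f g : P \subset S -> Q \subset S ->
  {in P, f =1 g} -> F P Q f -> F P Q g.
Proof. by case: fusF => H _ _ _ _; apply: H. Qed.

Lemma fus_HomS P Q f : P \subset S -> Q \subset S -> HomS S P Q f -> F P Q f.
Proof. by case: fusF => _ H _ _ _; apply: H. Qed.

Lemma fus_inj P Q f : P \subset S -> Q \subset S -> F P Q f -> injhom P Q f.
Proof. by case: fusF => _ _ H _ _; apply: H. Qed.

Lemma fus_comp P Q R f g : P \subset S -> Q \subset S -> R \subset S ->
  F P Q f -> F Q R g -> F P R (g \o f).
Proof. by case: fusF => _ _ _ H _; apply: H. Qed.

Lemma fus_incl P Q : P \subset Q -> Q \subset S -> F P Q id.
Proof.
move=> sPQ sQS; apply: fus_HomS => //; first exact: subset_trans sQS.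
exists 1; first exact: group1.
split=> [|x Px]; last by rewrite /conjm mul1g invg1 mulg1.
apply/subsetP=> _ /imsetP[x Px ->].
by rewrite mul1g invg1 mulg1 (subsetP sPQ).
Qed.

Lemma fus_conj P g : P \subset S -> g \in 'N_S(P) -> F P P (conjm g).
Proof.
move=> sPS /setIP[Sg Ng]; apply: fus_HomS => //; exists g => //; split=> //.
apply/subsetP=> _ /imsetP[x Px ->].
by rewrite -{1}[g]invgK -mulgA -conjgE memJ_norm ?groupV.
Qed.

Lemma Fiso_refl P : P \subset S -> Fiso F P P.
Proof. by move=> sPS; exists id, id; split=> //; apply: fus_incl. Qed.

Lemma Fiso_trans P Q R : P \subset S -> Q \subset S -> R \subset S ->
  Fiso F P Q -> Fiso F Q R -> Fiso F P R.
Proof.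
move=> sPS sQS sRS [f [f' [Ff Ff' ff' f'f]]] [g [g' [Fg Fg' gg' g'g]]].
have [_ _ fQ] := fus_inj sPS sQS Ff.
have [_ _ g'Q] := fus_inj sRS sQS Fg'.
exists (g \o f), (f' \o g'); split.
- exact: fus_comp Fg.
- exact: fus_comp Ff'.
- by move=> x Px /=; have /= -> := gg' _ (fQ x Px); apply: ff'.
- by move=> x Rx /=; have /= -> := f'f _ (g'Q x Rx); apply: g'g.
Qed.

Lemma fus_image_group P Q f : P \subset S -> Q \subset S -> F P Q f ->
  group_set (f @: P).
Proof.
move=> sPS sQS /fus_inj[] // fM _ _; apply/group_setP; split=> [|x y].
  apply/imsetP; exists 1; rewrite ?group1 //.
  by apply: (mulgI (f 1)); rewrite -fM ?group1 // !mulg1.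
move=> /imsetP[u Pu ->] /imsetP[v Pv ->].
by rewrite -fM //; apply: imset_f; rewrite groupM.
Qed.

Lemma fus_iso_image P Q f g : P \subset S -> Q \subset S ->
  F P Q f -> F Q P g -> {in Q, f \o g =1 id} -> f @: P = Q.
Proof.
move=> sPS sQS /fus_inj[] // _ _ fQ /fus_inj[] // _ _ gP fg.
apply/setP=> y; apply/imsetP/idP=> [[x Px ->]|Qy]; first exact: fQ.
by exists (g y); [apply: gP | have /= -> := fg y Qy].
Qed.

(** As long as [P] is not fully normalized, some conjugate has a strictly larger normalizer in [S];
    normalizer orders are bounded by [#|S|], so replacing [P] by it terminates. *)
Lemma fully_normalized_exists P : P \subset S ->
  exists R, [/\ R \subset S, Fiso F P R & fully_normalized S F R].
Proof.
have [n] := ubnP (#|S| - #|'N_S(P)|).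
elim: n P => // n IHn P; rewrite ltnS => leP sPS.
have [fnP|] := classic (fully_normalized S F P).
  by exists P; split=> //; apply: Fiso_refl.
move=> nfnP; have [P' nP'] := not_all_ex_not _ _ nfnP.
have [sP'S nisoP'] := imply_to_and _ _ nP'.
have [isoP' /negP] := imply_to_and _ _ nisoP'.
rewrite -ltnNge => ltN.
have leS : #|'N_S(P')| <= #|S| by rewrite subset_leq_card ?subsetIl.
have [|R [sRS isoR fnR]] := IHn P' _ sP'S.
  by apply: leq_trans leP; apply: ltn_sub2l => //; apply: leq_trans leS.
by exists R; split=> //; apply: Fiso_trans isoR.
Qed.

(** * Saturation without p'-automorphisms: every morphism is an S-conjugation *)

Hypothesis satF : saturated p S F.
Hypothesis p'aut_trivial : forall P (a : {perm gT}), P \subset S ->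
  a \in Aut P -> F P P a -> p^'.-elt a -> a = 1.

(** Saturation makes Aut_S(P) a Sylow p-subgroup of Aut_F(P), and the latter has no nontrivial
    p'-element, so the two coincide. *)
Lemma fully_normalized_aut_conj P f : P \subset S -> fully_normalized S F P ->
  F P P f ->
  exists h, [/\ h \in S, [set h * y * h^-1 | y in P] \subset P
              & {in P, f =1 conjm h}].
Proof.
move=> sPS fnP FPf; have [fM finj fP] := fus_inj sPS sPS FPf.
have [_ /(_ P sPS fnP)[_ [A [AE sylA]]] _] := satF.
have gA : group_set A.
  apply/group_setP; split=> [|a b /AE[Aa Fa] /AE[Ab Fb]].
    apply/AE; split; first exact: group1.
    by apply: fus_eq (fus_incl (subxx P) sPS) => // x _; rewrite perm1.
  apply/AE; split; first exact: groupM.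
  by apply: fus_eq (fus_comp sPS sPS sPS Fa Fb) => // x _; rewrite permM.
have eqA : A = AutS_set S P.
  apply: (Sylow_eq_of_p'_trivial (G := Group gA)
    (H := Group (AutS_set_group S P)) sylA) => a /AE[Aa Fa].
  exact: p'aut_trivial Fa.
have sfP : f @: P \subset P by apply/subsetP=> _ /imsetP[x Px ->]; apply: fP.
(* Only the values of [f] on [P] matter; [a] keeps these and is the identity elsewhere, as
   membership in [Aut P] demands. *)
pose a := perm_in finj sfP.
have af : {in P, a =1 f} by apply: perm_inE.
have : a \in A.
  apply/AE; split; last by apply: fus_eq FPf => // x Px; rewrite af.
  rewrite inE perm_in_on; apply/morphicP=> x y Px Py.
  by rewrite !af ?groupM // fM.
rewrite eqA inE => /andP[_ /existsP[h /andP[Sh /andP[hP /forall_inP ah]]]].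
by exists h; split=> // x Px; rewrite -af //; apply/eqP/ah.
Qed.

(* Aut_F(R) = Aut_S(R) forces N_phi = N_S(P), which is larger than P
   unless P = S. *)
Lemma fus_fully_normalized_conj P R f g : p.-group S ->
  (forall P' f', #|P| < #|P'| -> P' \subset S -> F P' S f' ->
     exists2 s, s \in S & {in P', f' =1 conjm s}) ->
  P \subset S -> R \subset S -> fully_normalized S F R ->
  F P R f -> F R P g -> {in P, g \o f =1 id} -> {in R, f \o g =1 id} ->
  exists2 s, s \in S & {in P, f =1 conjm s}.
Proof.
move=> pS IH sPS sRS fnR Ff Fg gf fg.
have imf := fus_iso_image sPS sRS Ff Fg fg.
have [_ finj fR] := fus_inj sPS sRS Ff.
(* For [P = S] there is nothing to extend to, but then [R = P] by order and [f] is already an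
   automorphism. *)
have [eqPS | neqPS] := eqVneq (P : {set gT}) S.
  have eqPR : P = R.
    apply/group_inj/esym/eqP; rewrite eqEcard eqPS sRS -eqPS.
    by rewrite -imf card_in_imset ?leqnn.
  rewrite -eqPR in Ff fnR.
  by have [s [Ss _ fs]] := fully_normalized_aut_conj sPS fnR Ff; exists s.
have ltPN : P \proper 'N_S(P).
  by rewrite (nilpotent_proper_norm (pgroup_nil pS)) // properEneq neqPS.
have NphiE : Nphi S P f = 'N_S(P).
  apply/setP=> n; rewrite inE; apply: andb_idr => Nn.
  (* The transport of conjugation by [n] is an automorphism of the fully normalized [R], hence
     conjugation by some [h] in [S], the witness required by [Nphi]. *)
  have Ft : F R R (f \o conjm n \o g).
    apply: fus_comp Fg _ => //.
    exact: fus_comp (fus_conj sPS Nn) Ff.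
  have [h [Sh hR th]] := fully_normalized_aut_conj sRS fnR Ft.
  apply/existsP; exists h; rewrite imf Sh hR /=.
  apply/forall_inP=> x Px; apply/eqP.
  have := th _ (fR _ Px); rewrite /= /conjm.
  by have /= -> := gf _ Px.
have FfS : F P S f.
  by apply: fus_eq (fus_comp sPS sRS (subxx S) Ff (fus_incl sRS (subxx S))).
have [_ fnc ext] := satF.
have [fcR _] := fnc R sRS fnR.
have [|psi []] := ext P f sPS FfS; first by rewrite imf.
rewrite NphiE => Fpsi psif.
have [s Ss psis] := IH _ _ (proper_card ltPN) (subsetIl _ _) Fpsi.
exists s => // x Px; rewrite -psif // psis //.
by rewrite (subsetP (proper_sub ltPN)).
Qed.

(** The image [Q] of [f] need not be fully normalized, so an isomorphism [u] from [Q] to a fully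
    normalized [R] is chosen. Both [u] and [u \o f] have fully normalized target, hence are
    conjugations by some [t] and [s], and [f] is conjugation by [t^-1 * s]. *)
Lemma fus_conj_of_p'aut_trivial P f : p.-group S -> P \subset S -> F P S f ->
  exists2 s, s \in S & {in P, f =1 conjm s}.
Proof.
move=> pS; have [n] := ubnP (#|S| - #|P|).
elim: n P f => // n IHn P f; rewrite ltnS => leP sPS Ff.
have IH P' f' : #|P| < #|P'| -> P' \subset S -> F P' S f' ->
    exists2 s, s \in S & {in P', f' =1 conjm s}.
  move=> ltPP' sP'S; apply: IHn => //; apply: leq_trans leP.
  apply: ltn_sub2l => //; apply: leq_trans ltPP' _.
  exact: subset_leq_card.
have [fM finj fS] := fus_inj sPS (subxx S) Ff.
pose Q := Group (fus_image_group sPS (subxx S) Ff).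
have sQS : Q \subset S by apply/subsetP=> _ /imsetP[x Px ->]; apply: fS.
have [_ _ _ _ /(_ P S f sPS (subxx S) Ff)[FfQ [g [Fg gf fg]]]] := fusF.
have fQ x : x \in P -> f x \in Q by apply: imset_f.
have cardQ : #|Q| = #|P| by rewrite card_in_imset.
have [R [sRS [u [v [Fu Fv vu uv]]] fnR]] := fully_normalized_exists sQS.
have [_ _ vQ] := fus_inj sRS sQS Fv.
(* The induction hypothesis for [P] also serves [Q], which has the same order. *)
have [|t St ut] :=
    fus_fully_normalized_conj (P := Q) pS _ sQS sRS fnR Fu Fv vu uv.
  by rewrite cardQ.
have Fuf : F P R (u \o f) by apply: (fus_comp (Q := Q)).
have Fgv : F R P (g \o v) by apply: (fus_comp (Q := Q)).
have gvuf : {in P, (g \o v) \o (u \o f) =1 id}.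
  by move=> x Px /=; have /= -> := vu _ (fQ x Px); apply: gf.
have ufgv : {in R, (u \o f) \o (g \o v) =1 id}.
  by move=> x Rx /=; have /= -> := fg _ (vQ x Rx); apply: uv.
have [s Ss ufs] :=
  fus_fully_normalized_conj pS IH sPS sRS fnR Fuf Fgv gvuf ufgv.
exists (t^-1 * s); first by rewrite groupM ?groupV.
move=> x Px; have := ufs x Px; rewrite /= ut ?fQ // /conjm => e.
apply: (mulgI t); apply: (mulIg t^-1).
by rewrite e invMg invgK !mulgA mulgV mul1g -!mulgA mulgV mulg1.
Qed.

End FusionSystem.

Theorem theorem7p4 (gT : finGroupType) (p : nat) (S : {group gT})
  (F : FusSys gT) (L : linking_data gT) :
  p_local_finite_group p S F L ->
  (nilpotent_fs S F <-> controls_Cp_fusion p S F).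
Proof.
case=> p_pr pS satF _; have [fusF _ _] := satF; split=> [nilF P sPS _ f | ctl].
  by case/(nilF P S f sPS (subxx S)) => s Ss [_ fs]; exists s.
have p'triv (P : {group gT}) (a : {perm gT}) : P \subset S ->
    a \in Aut P -> F P P a -> p^'.-elt a -> a = 1.
  move=> sPS Aa Fa p'a.
  (* For a C_p-element [x] of [P], the restriction of [a] to [<[x]>], viewed as a morphism to [S],
     is subject to the control hypothesis. *)
  apply: (coprime_aut_Cp_fusion_trivial p_pr pS sPS Aa p'a) => x Px Cpx.
  have sxP : <[x]> \subset P by rewrite cycle_subG.
  have sxS := subset_trans sxP sPS.
  have Fxa : F <[x]> S a.
    have Fxa := fus_comp fusF sxS sPS sPS (fus_incl fusF sxP sPS) Fa.
    have := fus_comp fusF sxS sPS (subxx S) Fxa (fus_incl fusF sPS (subxx S)).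
    exact: (fus_eq fusF).
  have [|s Ss as_] := ctl <[x]>%G sxS _ a Fxa.
    by exists x; rewrite ?(subsetP sPS).
  by exists s; rewrite ?as_ ?cycle_id.
move=> P Q f sPS sQS; split=> [Ff|]; last exact: (fus_HomS fusF).
have FfS : F P S f.
  have := fus_comp fusF sPS sQS (subxx S) Ff (fus_incl fusF sQS (subxx S)).
  exact: (fus_eq fusF).
have [s Ss fs] := fus_conj_of_p'aut_trivial fusF satF p'triv pS sPS FfS.
exists s => //; split=> //; have [_ _ fQ] := fus_inj fusF sPS sQS Ff.
by apply/subsetP=> _ /imsetP[x Px ->]; have := fQ x Px; rewrite fs.
Qed.
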